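(* There is no lower bounded lattice $L$ such that $\mathrm{Con}\,L\cong\boldsymbol{3}$.
   Context: For lattices $K$ and $L$, a lattice homomorphism $f\colon K\to L$ is lower bounded if for every $a\in L$ the set $\{x\in K\mid a\leq f(x)\}$ is either empty or has a least element. A lattice $L$ is lower bounded if every homomorphism from a finitely generated lattice to $L$ is lower bounded. $\mathrm{Con}\,L$ is the congruence lattice of $L$, and $\boldsymbol{3}$ is the three-element chain. No finiteness assumption is made on $L$. *)

(* Defs.v *)
From HB Require Import structures.
From mathcomp Require Import all_boot all_order.
From mathcomp Require Import boolp classical_sets.

Set Implicit Arguments.
Unset Strict Implicit.
Unset Printing Implicit Defensive.

Import Order.LTheory.
Local Open Scope classical_set_scope.

Definition sublattice {d} {K : latticeType d} (A : set K) : Prop :=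
  forall x y, A x -> A y -> A (x `&` y)%O /\ A (x `|` y)%O.

Definition finitely_generated {d} (K : latticeType d) : Prop :=
  exists s : seq K, smallest sublattice [set` s] = [set: K].

Definition has_least {d} {K : porderType d} (A : set K) : Prop :=
  exists2 m, A m & lbound A m.

Definition lower_bounded_hom {d d'} {K : latticeType d} {L : latticeType d'}
    (f : {lmorphism K -> L}) : Prop :=
  forall a : L, let A := [set x | (a <= f x)%O] in A = set0 \/ has_least A.

(* All lattice types share one universe; since a finitely generated lattice is
   countable, letting K range over that universe loses no generality. *)
Definition lower_bounded {d} (L : latticeType d) : Prop :=
  forall (d' : Order.disp_t) (K : latticeType d'), finitely_generated K ->
  forall f : {lmorphism K -> L}, lower_bounded_hom f.

Definition isomorphic_lattices {d d'} (K : latticeType d) (L : latticeType d')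
    : Prop :=
  exists f : {lmorphism K -> L}, bijective f.

Definition is_congruence {d} {L : latticeType d} (r : set (L * L)) : Prop :=
  [/\ forall x, r (x, x),
      forall x y, r (x, y) -> r (y, x),
      forall x y z, r (x, y) -> r (y, z) -> r (x, z),
      forall x1 y1 x2 y2, r (x1, y1) -> r (x2, y2) ->
        r (x1 `&` x2, y1 `&` y2)%O
    & forall x1 y1 x2 y2, r (x1, y1) -> r (x2, y2) ->
        r (x1 `|` x2, y1 `|` y2)%O].

Record Con {d} (L : latticeType d) := MkCon {
  con_graph :> set (L * L);
  con_graphP : `[< is_congruence con_graph >] }.

Fact con_display : Order.disp_t. Proof. exact: Order.Disp tt tt. Qed.

Section ConLattice.
Context {d : Order.disp_t} {L : latticeType d}.
Implicit Types r s t : Con L.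

HB.instance Definition _ := [isSub for @con_graph d L].
HB.instance Definition _ := [Choice of Con L by <:].

(* Congruences are ordered by inclusion of their graphs, the order of
   set (L * L). *)
HB.instance Definition _ :=
  [SubChoice_isSubPOrder of Con L by <: with con_display].

Lemma con_congr r : is_congruence r.
Proof. exact/asboolP/con_graphP. Qed.

Lemma leConE r s : (r <= s)%O = `[< (r : set _) `<=` s >].
Proof. by rewrite -Order.le_val; apply/idP/asboolP => /subsetPset. Qed.

Lemma is_congruence_bigcap I (D : set I) (F : I -> set (L * L)) :
  (forall i, D i -> is_congruence (F i)) ->
  is_congruence (\bigcap_(i in D) F i).
Proof.
move=> FP; split.
- by move=> x i /FP[].
- by move=> x y h i Di; have [_ + _ _ _] := FP i Di; apply; apply: h.
- move=> x y z h1 h2 i Di; have [_ _ + _ _] := FP i Di.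
  by apply; [apply: h1 | apply: h2].
- move=> ? ? ? ? h1 h2 i Di; have [_ _ _ + _] := FP i Di.
  by apply; [apply: h1 | apply: h2].
- move=> ? ? ? ? h1 h2 i Di; have [_ _ _ _] := FP i Di.
  by apply; [apply: h1 | apply: h2].
Qed.

Lemma con_meetP r s : `[< is_congruence ((r : set _) `&` s) >].
Proof.
apply/asboolP; rewrite -bigcap2E; apply: is_congruence_bigcap.
by move=> [|[|i]] _ //=; exact: con_congr.
Qed.

Lemma con_joinP r s :
  `[< is_congruence (smallest is_congruence ((r : set _) `|` s)) >].
Proof. by apply/asboolP/is_congruence_bigcap => t []. Qed.

Definition con_meet r s : Con L := MkCon (con_meetP r s).
Definition con_join r s : Con L := MkCon (con_joinP r s).

Fact con_lexI t r s : (t <= con_meet r s)%O = (t <= r)%O && (t <= s)%O.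
Proof.
rewrite !leConE; apply/asboolP/andP => [h|[/asboolP ? /asboolP ?]].
  by move: h; rewrite subsetI => -[? ?]; split; apply/asboolP.
by rewrite subsetI.
Qed.

Fact con_leUx r s t : (con_join r s <= t)%O = (r <= t)%O && (s <= t)%O.
Proof.
rewrite !leConE; apply/asboolP/andP => [h|[/asboolP rt /asboolP st]].
  by split; apply/asboolP => x ?; apply: h; apply: sub_gen_smallest;
    [left|right].
by apply: smallest_sub; [exact: con_congr | rewrite subUset].
Qed.

HB.instance Definition _ :=
  @Order.POrder_MeetJoin_isLattice.Build con_display (Con L)
    con_meet con_join con_lexI con_leUx.

End ConLattice.

(* Main.v *)
(* In a lower bounded lattice, x < y <= z < w forces con(x,y) <> con(z,w).
   When Con L is the chain 3, only two congruences are available for con(x,y)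
   with x < y, so L has no chain with four elements; in length at most 2 a
   prime element or its dual yields a congruence incomparable with the middle
   one.

   For the key fact, let X be a finite set containing the elements of
   derivations of both inclusions and let D be the sublattice it generates. A
   lattice of pairs (u, A), with (A n) an increasing sequence of lower subsets
   of D with union the elements below u, plays the role of the free lattice on
   X: a join at level n+1 only sees the binary joins of elements of level n.
   Lower boundedness of (u, A) |-> u gives every c in D a least pair b(c)
   above it; p has rank at most n when p is in the n-th level of b(p). An
   element of rank n below a nontrivial join can be traded for elements of
   smaller rank below the joinands. Following the derivation, an element that
   separates x from y yields one of no larger rank that separates z from w, and
   conversely; these cannot coincide, so ranks decrease forever. *)

Require Import Defs.
From HB Require Import structures.
From mathcomp Require Import all_boot all_order.
From mathcomp Require Import boolp classical_sets.

Set Implicit Arguments.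
Unset Strict Implicit.
Unset Printing Implicit Defensive.

Import Order.Theory.
Local Open Scope order_scope.

(** * Sequences of levels attached to lattice terms over [X] *)

Section Levels.
Context {d : Order.disp_t} {L : latticeType d} (X : seq L).

Definition gen_sub : set L := smallest sublattice [set` X]%classic.

Lemma gen_sub_gen x : x \in X -> gen_sub x.
Proof. by move=> Xx M [_]; apply. Qed.

Lemma gen_subI x y : gen_sub x -> gen_sub y -> gen_sub (x `&` y).
Proof.
move=> Dx Dy M MP; have [sM _] := MP.
exact: proj1 (sM _ _ (Dx M MP) (Dy M MP)).
Qed.

Lemma gen_subU x y : gen_sub x -> gen_sub y -> gen_sub (x `|` y).
Proof.
move=> Dx Dy M MP; have [sM _] := MP.
exact: proj2 (sM _ _ (Dx M MP) (Dy M MP)).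
Qed.

Definition down_lev (x : L) (n : nat) : set L := fun p => gen_sub p /\ p <= x.

Definition meet_lev (A B : nat -> set L) n : set L := fun p => A n p /\ B n p.

(* The least sequence above [A] and [B] in which the join of two elements of
   level [m] has level [m.+1]. *)
Fixpoint join_lev (A B : nat -> set L) n : set L := fun p =>
  [\/ A n p, B n p |
     if n is m.+1 then gen_sub p /\
       exists a b, [/\ join_lev A B m a, join_lev A B m b & p <= a `|` b]
     else False].

(** A relation rather than a function of the value: each term over [X] yields a sequence, and terms
    with equal values may yield different sequences. *)
Inductive levels : L -> (nat -> set L) -> Prop :=
| levels_gen x : x \in X -> levels x (down_lev x)
| levels_meet u v A B : levels u A -> levels v B ->
    levels (u `&` v) (meet_lev A B)
| levels_join u v A B : levels u A -> levels v B ->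
    levels (u `|` v) (join_lev A B).

Lemma levels_gen_sub u A : levels u A -> gen_sub u.
Proof.
elim=> [x /gen_sub_gen//|? ? ? ? _ ? _ ?|? ? ? ? _ ? _ ?].
- exact: gen_subI.
- exact: gen_subU.
Qed.

Lemma gen_sub_levels u : gen_sub u -> exists A, levels u A.
Proof.
move=> Du; apply: (Du [set v | exists A, levels v A]%classic).
split=> [x y [A lA] [B lB]|x Xx].
  by split; eexists; [apply: levels_meet lA lB | apply: levels_join lA lB].
by eexists; apply: levels_gen.
Qed.

Lemma levels_sub u A n p : levels u A -> A n p -> gen_sub p /\ p <= u.
Proof.
move=> lA; elim: lA n p => {u A}.
- by [].
- move=> u v A B _ IA _ IB n p [/IA[Dp pu] /IB[_ pv]].
  by rewrite lexI pu.
- move=> u v A B _ IA _ IB; elim=> [|n IH] p /=.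
    by case=> [/IA|/IB|//] [? ?]; split=> //; [apply: lexUl|apply: lexUr].
  case=> [/IA[? ?]|/IB[? ?]|[? [a [b [/IH[_ ?] /IH[_ ?] pab]]]]]; split=> //.
  - exact: lexUl.
  - exact: lexUr.
  - by apply: le_trans pab _; rewrite leUx; apply/andP.
Qed.

Lemma levels_down u A n p q : levels u A -> A n p -> gen_sub q -> q <= p ->
  A n q.
Proof.
move=> lA + Dq; elim: lA n p => {u A}.
- by move=> x _ n p [_ px] qp; split=> //; apply: le_trans px.
- by move=> u v A B _ IA _ IB n p [/IA + /IB +] qp; split; auto.
- move=> u v A B _ IA _ IB [|n] p /= [/IA|/IB|].
  + by move=> + qp => /(_ qp); constructor 1.
  + by move=> + qp => /(_ qp); constructor 2.
  + by [].
  + by move=> + qp => /(_ qp); constructor 1.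
  + by move=> + qp => /(_ qp); constructor 2.
  + move=> [_ [a [b [Wa Wb pab]]]] qp; constructor 3; split=> //.
    by exists a, b; split=> //; apply: le_trans pab.
Qed.

Lemma levels_joinS u A n p q : levels u A -> A n p -> A n q -> A n.+1 (p `|` q).
Proof.
move=> lA; elim: lA n p q => {u A}.
- move=> x _ n p q [Dp px] [Dq qx]; split; first exact: gen_subU.
  by rewrite leUx px.
- by move=> u v A B _ IA _ IB n p q [? ?] [? ?]; split; auto.
- move=> u v A B lA _ lB _ n p q Wp Wq; constructor 3.
  have W := levels_sub (levels_join lA lB).
  have [Dp _] := W _ _ Wp; have [Dq _] := W _ _ Wq.
  split; first exact: gen_subU.
  by exists p, q.
Qed.

(** An element is its own join with itself, so it passes to the next level. *)
Lemma levels_leq u A m n p : levels u A -> (m <= n)%N -> A m p -> A n p.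
Proof.
move=> lA /subnK <-; elim: (n - m)%N => [//|k IH] /IH Ap.
by rewrite addSn -[p]joinxx; apply: (levels_joinS lA).
Qed.

(** In the join case [u] and [v] occur at finite levels of their own sequences, and everything below
    their join enters one level after both. *)
Lemma levels_exhaust u A p : levels u A -> gen_sub p -> p <= u ->
  exists n, A n p.
Proof.
move=> lA; elim: lA p => {u A}.
- by move=> x _ p Dp px; exists 0%N.
- move=> u v A B lA IA lB IB p Dp; rewrite lexI => /andP[pu pv].
  have [[m Am] [n Bn]] := (IA p Dp pu, IB p Dp pv).
  exists (maxn m n); split.
    by apply: levels_leq lA _ Am; rewrite leq_maxl.
  by apply: levels_leq lB _ Bn; rewrite leq_maxr.
- move=> u v A B lA IA lB IB p Dp puv.
  have [m Am] := IA u (levels_gen_sub lA) (lexx u).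
  have [n Bn] := IB v (levels_gen_sub lB) (lexx v).
  exists (maxn m n).+1; constructor 3; split=> //; exists u, v.
  have lW := levels_join lA lB.
  split=> //.
    apply: (levels_leq lW (leq_maxl m n)).
    by case: (m) Am => [|k] ?; constructor 1.
  apply: (levels_leq lW (leq_maxr m n)).
  by case: (n) Bn => [|k] ?; constructor 2.
Qed.

Lemma sub_join_levl A B n p : A n p -> join_lev A B n p.
Proof. by case: n => [|n]; constructor 1. Qed.

Lemma sub_join_levr A B n p : B n p -> join_lev A B n p.
Proof. by case: n => [|n]; constructor 2. Qed.

Lemma join_lev_least A B w C : levels w C ->
  (forall n p, A n p -> C n p) -> (forall n p, B n p -> C n p) ->
  forall n p, join_lev A B n p -> C n p.
Proof.
move=> lC AC BC; elim=> [|n IH] p /= [/AC//|/BC//|//].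
move=> [Dp [a [b [/IH Ca /IH Cb pab]]]].
exact: levels_down lC (levels_joinS lC Ca Cb) Dp pab.
Qed.

(** * The finitely generated lattice of pairs and its least preimages *)

Record lev_lattice := LevLattice {
  lev_val : L;
  lev_fun : nat -> set L;
  lev_valP : levels lev_val lev_fun }.

HB.instance Definition _ := gen_eqMixin lev_lattice.
HB.instance Definition _ := gen_choiceMixin lev_lattice.

Definition lev_le (k l : lev_lattice) : bool :=
  `[< forall n p, lev_fun k n p -> lev_fun l n p >].

(** The value of [k] occurs in some level of [k], hence of [l], and all levels of [l] lie below its
    value. *)
Lemma lev_le_val k l : lev_le k l -> lev_val k <= lev_val l.
Proof.
move=> /asboolP kl; have lk := lev_valP k.
have [n kn] := levels_exhaust lk (levels_gen_sub lk) (lexx _).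
by have [] := levels_sub (lev_valP l) (kl _ _ kn).
Qed.

(** The order sees only the sequences, so antisymmetry needs a sequence to determine its value. *)
Lemma lev_fun_inj : injective lev_fun.
Proof.
move=> [u A lA] [v B lB] /= eAB; rewrite -eAB in lB *.
have le_uv u' v' (l1 : levels u' A) (l2 : levels v' A) : u' <= v'.
  by apply: (@lev_le_val (LevLattice l1) (LevLattice l2)); apply/asboolP.
have euv : u = v by apply/eqP; rewrite eq_le !le_uv.
by case: _ / euv in lB *; congr LevLattice; apply: Prop_irrelevance.
Qed.

Fact lev_le_refl : reflexive lev_le.
Proof. by move=> k; apply/asboolP. Qed.

Fact lev_le_anti : antisymmetric lev_le.
Proof.
move=> k l /andP[/asboolP kl /asboolP lk]; apply: lev_fun_inj.
by apply/funext => n; apply/funext => p; apply/propext; split=> [/kl|/lk].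
Qed.

Fact lev_le_trans : transitive lev_le.
Proof.
by move=> l k m /asboolP kl /asboolP lm; apply/asboolP => n p /kl /lm.
Qed.

HB.instance Definition _ :=
  Order.Le_isPOrder.Build d lev_lattice lev_le_refl lev_le_anti lev_le_trans.

Definition lev_meet k l := LevLattice (levels_meet (lev_valP k) (lev_valP l)).
Definition lev_join k l := LevLattice (levels_join (lev_valP k) (lev_valP l)).

Fact lev_lexI k l m : (k <= lev_meet l m) = (k <= l) && (k <= m).
Proof.
apply/asboolP/andP => [h|[/asboolP kl /asboolP km] n p kp].
  by split; apply/asboolP => n p /h[].
by split; [apply: kl | apply: km].
Qed.

Fact lev_leUx k l m : (lev_join k l <= m) = (k <= m) && (l <= m).
Proof.
apply/asboolP/andP => [h|[/asboolP km /asboolP lm]].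
  split; apply/asboolP => n p kp; apply: h.
    exact: sub_join_levl.
  exact: sub_join_levr.
exact: join_lev_least (lev_valP m) km lm.
Qed.

HB.instance Definition _ :=
  @Order.POrder_MeetJoin_isLattice.Build d lev_lattice
    lev_meet lev_join lev_lexI lev_leUx.

HB.instance Definition _ :=
  Order.isOrderMorphism.Build d lev_lattice d L lev_val lev_le_val.

Fact lev_val_meet : Order.meet_morphism lev_val. Proof. by []. Qed.
Fact lev_val_join : Order.join_morphism lev_val. Proof. by []. Qed.

HB.instance Definition _ :=
  Order.isMeetLatticeMorphism.Build d lev_lattice d L lev_val lev_val_meet.
HB.instance Definition _ :=
  Order.isJoinLatticeMorphism.Build d lev_lattice d L lev_val lev_val_join.

Definition lev_gens : seq lev_lattice :=
  pmap (fun x => if pselect (x \in X) is left Xx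
                 then Some (LevLattice (levels_gen Xx)) else None) X.

Lemma lev_lattice_fg : finitely_generated lev_lattice.
Proof.
exists lev_gens; apply/seteqP; split=> // -[u A lA] _ M [sM gM].
(* Induction on a copy of [lA] covers every proof that the record may carry. *)
have lA' := lA; elim: lA' lA => {u A}.
- move=> x Xx lA; apply: gM; rewrite /= mem_pmap; apply/mapP; exists x => //.
  case: pselect => // Xx'; congr Some; congr LevLattice.
  exact: Prop_irrelevance.
- move=> u v A B lA IA lB IB l.
  have [+ _] := sM _ _ (IA lA) (IB lB).
  by congr (M _); congr LevLattice; apply: Prop_irrelevance.
- move=> u v A B lA IA lB IB l.
  have [_] := sM _ _ (IA lA) (IB lB).
  by congr (M _); congr LevLattice; apply: Prop_irrelevance.
Qed.

(** Lower boundedness of [lev_val] gives a least pair with value above [c]; comparing it with any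
    pair of value [c] shows that its value is exactly [c]. *)
Lemma least_levels (c : L) : lower_bounded L -> gen_sub c ->
  exists A, levels c A /\
    forall v B, levels v B -> c <= v -> forall n p, A n p -> B n p.
Proof.
move=> lbL Dc; have [A0 lA0] := gen_sub_levels Dc.
have [|[[u A lA] /= cu least]] := lbL _ _ lev_lattice_fg lev_val c.
  move=> /seteqP[/(_ (LevLattice lA0)) /= + _].
  by rewrite lexx => /(_ isT).
exists A; have least' v B : levels v B -> c <= v -> forall n p, A n p -> B n p.
  by move=> lB cv; have /asboolP := least (LevLattice lB) cv.
split=> //; suff -> : c = u by [].
apply/eqP; rewrite eq_le cu /=.
apply: (@lev_le_val (LevLattice lA) (LevLattice lA0)); apply/asboolP.
exact: least' lA0 (lexx c).
Qed.

(* Although [gen_sub] may be infinite, only finitely many sets occur as the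
   [n]-th level of a pair. *)
Lemma levels_saturated n : exists (T : finType) (phi : L -> T),
  forall u A p q, levels u A -> gen_sub p -> gen_sub q -> phi p = phi q ->
    A n p -> A n q.
Proof.
elim: n => [|n [T [phi phiP]]].
  (* Membership in a level 0 depends only on which generators lie above [p]. *)
  exists {ffun seq_sub X -> bool}, (fun p => [ffun x => p <= ssval x]).
  move=> u A p q lA Dp Dq /ffunP pq; elim: lA => {u A}.
  - move=> x Xx [_ px]; split=> //.
    by have := pq (SeqSub Xx); rewrite !ffunE /= => <-.
  - by move=> u v A B _ IA _ IB [/IA ? /IB ?].
  - by move=> u v A B _ IA _ IB [/IA|/IB|//]; [constructor 1|constructor 2].
(* Besides the generators above [p], [psi] records for which sets of [phi]-classes [p] lies below a
   join of two elements with classes in that set. *)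
pose psi p := ([ffun x : seq_sub X => p <= ssval x],
  [ffun S : {set T} => `[< exists a b, [/\ gen_sub a, gen_sub b,
     phi a \in S, phi b \in S & p <= a `|` b] >]]).
exists ({ffun seq_sub X -> bool} * {ffun {set T} -> bool})%type, psi.
move=> u A p q lA Dp Dq [/ffunP pq /ffunP pqS]; elim: lA => {u A}.
- move=> x Xx [_ px]; split=> //.
  by have := pq (SeqSub Xx); rewrite !ffunE /= => <-.
- by move=> u v A B _ IA _ IB [/IA ? /IB ?].
- move=> u v A B lA IA lB IB [/IA|/IB|]; [constructor 1|constructor 2|] => //.
  move=> [_ [a [b [Wa Wb pab]]]]; constructor 3; split=> //.
  have lW := levels_join lA lB.
  (* Level [n] is a union of [phi]-classes, so being below a join of two of its elements can be read
     off [psi] at this [S]. *)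
  pose S := [set t | `[< exists2 c, join_lev A B n c & phi c = t >]].
  have WS c : gen_sub c -> phi c \in S -> join_lev A B n c.
    move=> Dc; rewrite inE => /asboolP[c' Wc' e].
    have [Dc' _] := levels_sub lW Wc'.
    exact: phiP lW Dc' Dc e Wc'.
  have SW c : join_lev A B n c -> phi c \in S.
    by move=> Wc; rewrite inE; apply/asboolP; exists c.
  have : (psi q).2 S.
    rewrite /= -pqS ffunE; apply/asboolP; exists a, b; split; auto.
    - by have [] := levels_sub lW Wa.
    - by have [] := levels_sub lW Wb.
  rewrite ffunE => /asboolP[a' [b' [? ? ? ? ?]]].
  by exists a', b'; split; auto.
Qed.
End Levels.

(** * Trading an element below a join for one of smaller rank *)

Lemma exists_argmin {T : Type} (P : T -> Prop) (m : T -> nat) x : P x ->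
  exists2 y, P y & forall z, P z -> (m y <= m z)%N.
Proof.
move=> Px; pose Q n := `[< exists2 y, P y & m y = n >].
have exQ : exists n, Q n by exists (m x); apply/asboolP; exists x.
have [n /asboolP[y Py <-] minn] := ex_minnP exQ.
by exists y => // z Pz; apply: minn; apply/asboolP; exists z.
Qed.

Inductive ideal_gen {d} {L : latticeType d} (S : set L) : set L :=
| ideal_gen_base c : S c -> ideal_gen S c
| ideal_gen_join a b : ideal_gen S a -> ideal_gen S b ->
    ideal_gen S (a `|` b)%O
| ideal_gen_down a b : ideal_gen S a -> (b <= a)%O -> ideal_gen S b.

Lemma ideal_gen_bound {d} {L : latticeType d} (S : set L) t :
  (forall c, S c -> c <= t) -> forall p, ideal_gen S p -> p <= t.
Proof.
move=> St p; elim=> [//|a b _ at_ _ bt|a b _ at_ ba]; first by rewrite leUx at_.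
exact: le_trans ba at_.
Qed.

Section Descent.
Context {d : Order.disp_t} {L : latticeType d} (X : seq L).
Context (b : L -> nat -> set L).
Context (b_levels : forall c, gen_sub X c -> levels X c (b c)).
Context (b_least : forall c v B, gen_sub X c -> levels X v B -> c <= v ->
  forall n p, b c n p -> B n p).

Let D := gen_sub X.

Definition rank_le n p := D p /\ b p n p.

Lemma rank_exists p : D p -> exists n, rank_le n p.
Proof.
move=> Dp; have [n ?] := levels_exhaust (b_levels Dp) Dp (lexx p).
by exists n.
Qed.

Lemma join_lev_ideal (S : set L) n u v A B :
  levels X u A -> levels X v B ->
  (forall p, A n p -> ideal_gen S p) -> (forall p, B n p -> ideal_gen S p) ->
  forall p, join_lev X A B n p -> ideal_gen S p.
Proof.
move=> lA lB AS BS.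
suff H m p : (m <= n)%N -> join_lev X A B m p -> ideal_gen S p.
  by move=> p; apply: H.
elim: m p => [|m IH] p mn /= [Ap|Bp|].
- exact/AS/(levels_leq lA mn).
- exact/BS/(levels_leq lB mn).
- by [].
- exact/AS/(levels_leq lA mn).
- exact/BS/(levels_leq lB mn).
- move=> [_ [a [c [/(IH _ (ltnW mn)) Sa /(IH _ (ltnW mn)) Sc pac]]]].
  exact: ideal_gen_down (ideal_gen_join Sa Sc) pac.
Qed.

Definition refine n (S : set L) : set L := fun q => exists2 c, S c & b c n q.

(** Along the derivation of [p] from [S], the [b c] are joined into a pair with value above [p].
    Each element of its level [n.+1] is below a member of [S] or in the refined ideal. Leastness of
    [b p] puts [p] in that level, and the first case is excluded. *)
Lemma rank_le_refine n p (S : set L) : rank_le n.+1 p ->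
  (forall c, S c -> D c /\ ~~ (p <= c)) ->
  ideal_gen S p -> ideal_gen (refine n S) p.
Proof.
move=> [Dp bp] SD.
have H r : ideal_gen S r -> exists v A, [/\ levels X v A, r <= v,
    forall q, A n q -> ideal_gen (refine n S) q &
    forall q, A n.+1 q -> (exists2 c, S c & q <= c) \/ ideal_gen (refine n S) q].
  elim=> {r} [c Sc|r s _ [v [A [lA rv AS AS']]] _ [w [B [lB sw BS BS']]]|].
  - have [Dc _] := SD _ Sc; have lb := b_levels Dc.
    exists c, (b c); split=> // q bq; first by constructor 1; exists c.
    by left; exists c => //; have [] := levels_sub lb bq.
  - exists (v `|` w), (join_lev X A B).
    have lW := levels_join lA lB; split=> //.
    + by rewrite leU2.
    + exact: join_lev_ideal lA lB AS BS.
    + move=> q /= [/AS'|/BS'|[_ [a [c [Wa Wc qac]]]]] //; right.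
      have W := join_lev_ideal lA lB AS BS.
      exact: ideal_gen_down (ideal_gen_join (W _ Wa) (W _ Wc)) qac.
  - move=> r s _ [v [A [lA rv AS AS']]] sr.
    by exists v, A; split=> //; apply: le_trans rv.
move=> /H[v [A [lA pv _ AS']]].
have [[c Sc pc]|//] := AS' p (b_least Dp lA pv bp).
by have [_ /negP] := SD _ Sc.
Qed.

(** Rank 0 would put [p] below a joinand. Otherwise [p] lies in the ideal of a set of elements below
    [a1] or [a2] that is stable under refinement; not all of it is below [t], and a suitable member
    has smaller rank. *)
Lemma rank_descent n p a1 a2 t : rank_le n p -> D a1 -> D a2 ->
  p <= a1 `|` a2 -> ~~ (p <= a1) -> ~~ (p <= a2) -> ~~ (p <= t) ->
  exists m q, [/\ (m < n)%N, rank_le m q, ~~ (q <= t) & (q <= a1) || (q <= a2)].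
Proof.
move=> rp Da1 Da2 pa pa1 pa2 pt; have [Dp bp] := rp.
case: n => [|n] in rp bp *.
  have lW := levels_join (b_levels Da1) (b_levels Da2).
  have [/(levels_sub (b_levels Da1))[_]|/(levels_sub (b_levels Da2))[_]|//]
    := b_least Dp lW pa bp.
  - by rewrite (negbTE pa1).
  - by rewrite (negbTE pa2).
have [T [phi sat]] := levels_saturated X n.
pose img (S : set L) := [set u | `[< exists2 q, S q & phi q = u >]].
have imgS (S S' : set L) : (forall q, S q -> S' q) -> img S \subset img S'.
  move=> SS'; apply/fintype.subsetP => u; rewrite !inE.
  by move=> [q Sq e]; exists q => //; apply: SS'.
(* [S] is squeezed until its level-[n] refinement has as few [phi]-classes as
   possible; that refinement [T0] then refines to itself. *)
pose adm (S : set L) := (forall c, S c -> D c /\ ((c <= a1) || (c <= a2))) /\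
  ideal_gen S p.
have adm0 : adm (fun c => D c /\ ((c <= a1) || (c <= a2))).
  split=> //; apply: ideal_gen_down pa.
  by apply: ideal_gen_join; constructor 1; rewrite lexx ?orbT.
have [S [Ssub Sp] minS] := exists_argmin (fun S => #|img (refine n S)|) adm0.
have pS c : S c -> D c /\ ~~ (p <= c).
  move=> Sc; have [Dc ca] := Ssub _ Sc; split=> //.
  by apply/negP => pc; move: ca => /orP[] /(le_trans pc); apply/negP.
set T0 := refine n S in minS *.
have T0sub c : T0 c -> D c /\ ((c <= a1) || (c <= a2)).
  move=> [c' /Ssub[Dc' c'a] bc]; have [Dc cc'] := levels_sub (b_levels Dc') bc.
  by split=> //; case/orP: c'a => /(le_trans cc') ->; rewrite ?orbT.
have admT0 : adm T0 by split=> //; apply: rank_le_refine rp pS Sp.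
have T0T0 q : refine n T0 q -> T0 q.
  move=> [c [c' Sc' bc] bq]; exists c' => //.
  have [Dc' _] := Ssub _ Sc'; have [Dc cc'] := levels_sub (b_levels Dc') bc.
  exact: b_least Dc (b_levels Dc') cc' _ _ bq.
have T0fix q : T0 q -> refine n T0 q.
  move=> Tq; have /eqP e : img (refine n T0) == img T0.
    by rewrite eqEcard imgS//= minS.
  have : phi q \in img T0 by rewrite inE; apply/asboolP; exists q.
  rewrite -e inE => /asboolP[q' [c Tc bq'] eq'].
  exists c => //; have [[Dc _] [Dq _]] := (T0sub _ Tc, T0sub _ Tq).
  have [Dq' _] := levels_sub (b_levels Dc) bq'.
  exact: sat (b_levels Dc) Dq' Dq eq' bq'.
have [q0 [Tq0 q0t]] : exists q, T0 q /\ ~~ (q <= t).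
  apply: contrapT => noq; case/negP: pt.
  apply: (ideal_gen_bound _ admT0.2) => c Tc.
  by apply: contrapT => /negP ct; apply: noq; exists c.
have [q [Tq qt] maxq] :=
  exists_argmin (P := fun q => T0 q /\ ~~ (q <= t))
    (* Subtraction from [#|T|] turns the minimum into a maximum of the number of classes. *)
    (fun q => #|T| - #|img (b q n)|)%N (conj Tq0 q0t).
have [Dq qa] := T0sub _ Tq.
exists n, q; split=> //; split=> //.
(* Here [q <= c], so [c] also escapes [t] and level [n] of [b c] contains that of [b q]. By
   maximality both have the same classes, and saturation puts [q] into [b q n]. *)
have [c Tc bcq] := T0fix _ Tq; have [Dc _] := T0sub _ Tc.
have [_ qc] := levels_sub (b_levels Dc) bcq.
have ct : ~~ (c <= t) by apply: contra qt; apply: le_trans.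
have /eqP e : img (b q n) == img (b c n).
  rewrite eqEcard imgS /=; last first.
    by move=> r; apply: b_least Dq (b_levels Dc) qc _ _.
  by have := maxq _ (conj Tc ct); rewrite leq_sub2lE// max_card.
have : phi q \in img (b c n) by rewrite inE; apply/asboolP; exists q.
rewrite -e inE => /asboolP[q' bq' eq'].
have [Dq' _] := levels_sub (b_levels Dq) bq'.
exact: sat (b_levels Dq) Dq' Dq eq' bq'.
Qed.

End Descent.

(** * Derivations of principal congruences and their finite support *)

(** [A] constrains only the leaves of a derivation, so a finite [A] always suffices; if [A] is a
    sublattice, all derived elements stay in it. *)
Inductive cong_gen {d} {L : latticeType d} (A : set L) (x y : L) :
    L -> L -> Prop :=
| cong_gen_gen : A x -> A y -> cong_gen A x y x y
| cong_gen_refl u : A u -> cong_gen A x y u u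
| cong_gen_sym u v : cong_gen A x y u v -> cong_gen A x y v u
| cong_gen_trans u v w : cong_gen A x y u v -> cong_gen A x y v w ->
    cong_gen A x y u w
| cong_gen_meet u1 v1 u2 v2 : cong_gen A x y u1 v1 -> cong_gen A x y u2 v2 ->
    cong_gen A x y (u1 `&` u2)%O (v1 `&` v2)%O
| cong_gen_join u1 v1 u2 v2 : cong_gen A x y u1 v1 -> cong_gen A x y u2 v2 ->
    cong_gen A x y (u1 `|` u2)%O (v1 `|` v2)%O.

Lemma sub_cong_gen {d} {L : latticeType d} (A B : set L) x y u v :
  (forall c, A c -> B c) -> cong_gen A x y u v -> cong_gen B x y u v.
Proof.
move=> AB; elim=> {u v}; [|move=> ?|move=> ? ? _|move=> ? ? ? _ + _|
  move=> ? ? ? ? _ + _|move=> ? ? ? ? _ + _].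
- by move=> /AB + /AB; constructor 1.
- by move=> /AB; constructor 2.
- by constructor 3.
- exact: cong_gen_trans.
- by constructor 5.
- by constructor 6.
Qed.

Lemma cong_gen_support {d} {L : latticeType d} (A : set L) (x y u v : L) :
  cong_gen A x y u v -> exists X : seq L, cong_gen [set` X]%classic x y u v.
Proof.
have sub X1 X2 (a b : L) : (forall c, c \in X1 -> c \in X2) ->
    cong_gen [set` X1]%classic x y a b -> cong_gen [set` X2]%classic x y a b.
  by move=> s12; apply: sub_cong_gen.
elim=> {u v}.
- by exists [:: x; y]; constructor 1; rewrite /= !inE eqxx ?orbT.
- by move=> u _; exists [:: u]; constructor 2; rewrite /= inE.
- by move=> u v _ [X cX]; exists X; constructor 3.
- move=> u v w _ [X cX] _ [Y cY]; exists (X ++ Y).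
  apply: (@cong_gen_trans _ _ _ _ _ _ v).
    by apply: sub cX => c; rewrite mem_cat => ->.
  by apply: sub cY => c; rewrite mem_cat => ->; rewrite orbT.
- move=> u1 v1 u2 v2 _ [X cX] _ [Y cY]; exists (X ++ Y); constructor 5.
    by apply: sub cX => c; rewrite mem_cat => ->.
  by apply: sub cY => c; rewrite mem_cat => ->; rewrite orbT.
- move=> u1 v1 u2 v2 _ [X cX] _ [Y cY]; exists (X ++ Y); constructor 6.
    by apply: sub cX => c; rewrite mem_cat => ->.
  by apply: sub cY => c; rewrite mem_cat => ->; rewrite orbT.
Qed.

Lemma cong_gen_gen_sub {d} {L : latticeType d} (X : seq L) (x y u v : L) :
  cong_gen (gen_sub X) x y u v -> gen_sub X u /\ gen_sub X v.
Proof.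
elim=> {u v} //.
- by move=> u v _ [].
- by move=> u v w _ [? _] _ [_].
- by move=> u1 v1 u2 v2 _ [? ?] _ [? ?]; split; apply: gen_subI.
- by move=> u1 v1 u2 v2 _ [? ?] _ [? ?]; split; apply: gen_subU.
Qed.

(** * Separating elements followed along derivations *)

Definition sep {d} {L : latticeType d} (p u v : L) := (p <= u) != (p <= v).

Lemma sepC {d} {L : latticeType d} (p u v : L) : sep p u v = sep p v u.
Proof. by rewrite /sep eq_sym. Qed.

Section Separation.
Context {d : Order.disp_t} {L : latticeType d} (X : seq L).
Context (b : L -> nat -> set L).
Context (b_levels : forall c, gen_sub X c -> levels X c (b c)).
Context (b_least : forall c v B, gen_sub X c -> levels X v B -> c <= v ->
  forall n p, b c n p -> B n p).

(** Only a join can force a change of separator, and then [rank_descent] lowers the rank strictly;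
    hence equal rank comes with [q = p]. *)
Lemma cong_gen_descent x y u v n p : cong_gen (gen_sub X) x y u v ->
  rank_le X b n p -> sep p u v ->
  exists m q, [/\ (m < n)%N \/ m = n /\ q = p, rank_le X b m q & sep q x y].
Proof.
move=> cuv; elim: cuv n p => {u v}.
- by move=> _ _ n p rp sp; exists n, p; split=> //; right.
- by move=> u _ n p _; rewrite /sep eqxx.
- by move=> u v _ IH n p rp; rewrite sepC; apply: IH.
- move=> u v w _ IH1 _ IH2 n p rp spw.
  have [/IH1|/negbNE/eqP e] := boolP (sep p u v); first exact.
  by apply: IH2 rp _; rewrite /sep -e.
- move=> u1 v1 u2 v2 _ IH1 _ IH2 n p rp; rewrite /sep !lexI => spw.
  have [/IH1|/negbNE/eqP e] := boolP (sep p u1 v1); first exact.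
  by apply: IH2 rp _; apply: contra spw => /eqP->; rewrite e.
- move=> u1 v1 u2 v2 c1 IH1 c2 IH2 n p rp.
  (* [p] may lie below either of the two joins; [H] serves both orientations. *)
  suff H a1 b1 a2 b2 : gen_sub X a1 -> gen_sub X a2 ->
      (forall q, sep q a1 b1 -> sep q u1 v1) ->
      (forall q, sep q a2 b2 -> sep q u2 v2) ->
      p <= a1 `|` a2 -> ~~ (p <= b1 `|` b2) ->
      exists m q, [/\ (m < n)%N \/ m = n /\ q = p, rank_le X b m q & sep q x y].
    have [[Du1 Dv1] [Du2 Dv2]] := (cong_gen_gen_sub c1, cong_gen_gen_sub c2).
    rewrite /sep; have [pu|pu] := boolP (p <= u1 `|` u2).
      by rewrite /= eq_sym eqb_id => pv; apply: (H u1 v1 u2 v2).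
    case pv: (p <= v1 `|` v2) => // _.
    by apply: (H v1 u1 v2 u2) => // q; rewrite sepC.
  move=> Da1 Da2 s1 s2 pa pb.
  have pb1 : ~~ (p <= b1) by apply: contra pb; apply: lexUl.
  have pb2 : ~~ (p <= b2) by apply: contra pb; apply: lexUr.
  have [pa1|pa1] := boolP (p <= a1).
    by apply: IH1 rp _; apply: s1; rewrite /sep pa1 (negbTE pb1).
  have [pa2|pa2] := boolP (p <= a2).
    by apply: IH2 rp _; apply: s2; rewrite /sep pa2 (negbTE pb2).
  have [m [q [mn rq qb qa]]] :=
    rank_descent b_levels b_least rp Da1 Da2 pa pa1 pa2 pb.
  have qb1 : ~~ (q <= b1) by apply: contra qb; apply: lexUl.
  have qb2 : ~~ (q <= b2) by apply: contra qb; apply: lexUr.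
  have [k [r [kr rr sr]]] : exists k r,
      [/\ (k < m)%N \/ k = m /\ r = q, rank_le X b k r & sep r x y].
    case/orP: qa => qa.
      by apply: IH1 rq _; apply: s1; rewrite /sep qa (negbTE qb1).
    by apply: IH2 rq _; apply: s2; rewrite /sep qa (negbTE qb2).
  exists k, r; split=> //; left.
  by case: kr => [km|[-> _]//]; apply: ltn_trans mn.
Qed.

End Separation.

Lemma lower_bounded_con_neq {d} {L : latticeType d} (x y z w : L) :
  lower_bounded L -> x < y -> y <= z -> z <= w ->
  cong_gen setT x y z w -> cong_gen setT z w x y -> False.
Proof.
move=> lbL xy yz zw /cong_gen_support[X1 c1] /cong_gen_support[X2 c2].
(* [y] is included because it is the first element separating [x] from [y]. *)
pose X := y :: X1 ++ X2.
have {}c1 : cong_gen (gen_sub X) x y z w.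
  apply: sub_cong_gen c1 => c /= Xc; apply: gen_sub_gen.
  by rewrite in_cons mem_cat Xc orbT.
have {}c2 : cong_gen (gen_sub X) z w x y.
  apply: sub_cong_gen c2 => c /= Xc; apply: gen_sub_gen.
  by rewrite in_cons mem_cat Xc !orbT.
have /choice[b bP] : forall c, exists A, gen_sub X c -> levels X c A /\
    forall v B, levels X v B -> c <= v -> forall n p, A n p -> B n p.
  move=> c; have [Dc|nDc] := pselect (gen_sub X c).
    by have [A] := least_levels lbL Dc; exists A.
  by exists (fun _ _ => False).
have b_levels c : gen_sub X c -> levels X c (b c) by move=> /bP[].
have b_least c v B : gen_sub X c -> levels X v B -> c <= v ->
    forall n p, b c n p -> B n p.
  by move=> /bP[_ h]; apply: h.
have Dy : gen_sub X y by apply: gen_sub_gen; rewrite in_cons eqxx.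
have sy : sep y x y by rewrite /sep lexx lt_geF.
suff H n p : rank_le X b n p -> sep p x y -> False.
  by have [n rn] := rank_exists b_levels Dy; apply: H rn sy.
elim/ltn_ind: n p => n IH p rp sp.
(* Thus [p] lies below both [z] and [w], so it cannot separate them and the next rank is strictly
   smaller. *)
have py : p <= y.
  by apply: contraT => npy; move: sp; rewrite /sep (negbTE npy);
    rewrite eqbF_neg negbK => /le_trans/(_ (ltW xy)); rewrite (negbTE npy).
have [m [q [mn rq sq]]] := cong_gen_descent b_levels b_least c2 rp sp.
have {}mn : (m < n)%N.
  case: mn => // -[_ eq]; move: sq.
  by rewrite eq /sep (le_trans py yz) (le_trans (le_trans py yz) zw) eqxx.
have [k [r [km rr sr]]] := cong_gen_descent b_levels b_least c1 rq sq.
apply: IH rr sr; case: km => [km|[-> _]//]; exact: ltn_trans mn.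
Qed.

(** * Particular elements of the congruence lattice *)

Lemma cong_gen_is_congruence {d} {L : latticeType d} (x y : L) :
  is_congruence [set p | cong_gen setT x y p.1 p.2]%classic.
Proof.
split=> /=.
- by move=> u; constructor 2.
- by move=> u v; constructor 3.
- by move=> u v w; apply: cong_gen_trans.
- by move=> u1 v1 u2 v2; apply: cong_gen_meet.
- by move=> u1 v1 u2 v2; apply: cong_gen_join.
Qed.

Definition con_gen {d} {L : latticeType d} (x y : L) : Con L :=
  MkCon (asboolT (cong_gen_is_congruence x y)).

Lemma con_gen_gen {d} {L : latticeType d} (x y : L) :
  con_graph (con_gen x y) (x, y).
Proof. by constructor 1. Qed.

Lemma con_gen_least {d} {L : latticeType d} (r : Con L) (x y : L) p :
  con_graph r (x, y) -> con_graph (con_gen x y) p -> con_graph r p.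
Proof.
have [rR rS rT rI rU] := con_congr r.
move=> rxy; case: p => u v /=; elim=> {u v}; eauto.
Qed.

(** [P] is a homomorphism to the two-element chain. *)
Lemma kernel_is_congruence {d} {L : latticeType d} (P : pred L) :
  {morph P : u v / u `&` v >-> u && v} -> {morph P : u v / u `|` v >-> u || v} ->
  is_congruence [set p | P p.1 = P p.2]%classic.
Proof.
move=> PI PU; split=> //=.
- by move=> u v w -> ->.
- by move=> u1 v1 u2 v2; rewrite !PI => -> ->.
- by move=> u1 v1 u2 v2; rewrite !PU => -> ->.
Qed.

Lemma diag_is_congruence {d} {L : latticeType d} :
  is_congruence [set p : L * L | p.1 = p.2]%classic.
Proof. by split=> //= [u v w -> ->|? ? ? ? -> ->|? ? ? ? -> ->]. Qed.

Lemma full_is_congruence {d} {L : latticeType d} :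
  is_congruence ([set: L * L]%classic).
Proof. by []. Qed.

Definition diag_con {d} {L : latticeType d} : Con L :=
  MkCon (asboolT diag_is_congruence).
Definition full_con {d} {L : latticeType d} : Con L :=
  MkCon (asboolT full_is_congruence).

Lemma con_ext {d} {L : latticeType d} (r s : Con L) :
  (forall p, con_graph r p <-> con_graph s p) -> r = s.
Proof.
move=> rs; apply: val_inj; apply/funext => p /=; apply/propext; exact: rs.
Qed.

(** * Bounded lattices of length two *)

Definition no4chain {d} (L : porderType d) :=
  forall x y z w : L, x < y -> y < z -> z < w -> False.

(** If [u] and [v] are not above [m] but their join is, length two makes [i] the join of [m] with
    either, so both are congruent to [i]. Their meet is [o], whence [o], and then [m], is congruent
    to [i]. *)
Lemma length2_prime {d} (L : latticeType d) (r : set (L * L)) (o m i : L) :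
  no4chain L -> (forall u, o <= u <= i) -> o < m < i -> is_congruence r ->
  r (o, m) -> ~ r (m, i) ->
  {morph (fun u => m <= u) : u v / u `|` v >-> u || v}.
Proof.
move=> n4 oi /andP[om mi] [rR rS rT rI rU] rom rmi u v.
have o_le w : o <= w by have /andP[] := oi w.
have i_ge w : w <= i by have /andP[] := oi w.
have r_i w w' : m <= w `|` w' -> ~~ (m <= w) -> ~~ (m <= w') -> r (w, i).
  move=> mww mw mw'; have := rU _ _ _ _ rom (rR w).
  suff -> : m `|` w = i by rewrite (join_idPr (o_le w)).
  have wm : ~~ (w <= m).
    apply/negP => wm.
    have wm' : w < m by rewrite lt_leAnge wm.
    have [ow|/eqP ow] := eqVneq o w.
      by move: mww; rewrite -ow (join_idPr (o_le w')) (negbTE mw').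
    apply: (n4 o w m i) => //; rewrite lt_neqAle o_le andbT; exact/eqP.
  apply/eqP/contraT => mwi; exfalso; apply: (n4 o m (m `|` w) i) => //.
    by rewrite lt_leAnge leUl leUx negb_and wm orbT.
  by rewrite lt_neqAle mwi i_ge.
apply/idP/orP => [muv|[]]; last 2 first.
- exact: lexUl.
- exact: lexUr.
apply/orP/contraT; rewrite negb_or => /andP[mu mv]; exfalso; apply: rmi.
have rui := r_i _ _ muv mu mv.
have rvi : r (v, i) by apply: (r_i v u) => //; rewrite joinC.
have ouv : u `&` v = o.
  apply/eqP/contraT => uvo; exfalso; apply: (n4 o (u `&` v) u i).
  - by rewrite lt_neqAle eq_sym uvo o_le.
  - rewrite lt_leAnge leIl lexI lexx /=; apply/negP => uv.
    by move: muv; rewrite (join_idPr uv) (negbTE mv).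
  - rewrite lt_leAnge i_ge; apply/negP => iu.
    by move/negP: mu; apply; apply: le_trans iu.
have := rI _ _ _ _ rui rvi; rewrite ouv meetxx => roi.
have := rU _ _ _ _ roi (rR m).
by rewrite (join_idPr (ltW om)) (join_idPl (ltW mi)).
Qed.

Lemma length2_coprime {d} (L : latticeType d) (r : set (L * L)) (o m i : L) :
  no4chain L -> (forall u, o <= u <= i) -> o < m < i -> is_congruence r ->
  r (m, i) -> ~ r (o, m) ->
  {morph (fun u => u <= m) : u v / u `&` v >-> u || v}.
Proof.
move=> n4 oi omi [rR rS rT rI rU] rmi rom.
apply: (@length2_prime _ L^d r i m o).
- by move=> x y z w xy yz zw; apply: (n4 w z y x).
- by move=> u; have := oi u; rewrite andbC.
- by move: omi; rewrite andbC.
- by split.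
- exact: rS.
- by move=> /rS.
Qed.

(** * Counting and comparing congruences when there are three *)

Lemma bij_ord3_neq {T : choiceType} (f : T -> 'I_3) (a b : T) : bijective f ->
  exists r, r <> a /\ r <> b.
Proof.
move=> [g fK gK].
have /existsP[i] : [exists i, i \notin [set f a; f b]].
  rewrite -negb_forall; apply/negP => /forallP h.
  have : #|[set: 'I_3]| <= #|[set f a; f b]|.
    by apply/subset_leq_card/fintype.subsetP => j _; apply: h.
  by rewrite cardsT card_ord cards2; case: eqP.
rewrite !inE negb_or => /andP[/eqP ia /eqP ib].
by exists (g i); split=> e; [apply: ia | apply: ib]; rewrite -e gK.
Qed.

Lemma bij_ord3_pigeonhole {T : choiceType} (f : T -> 'I_3) (a b c e : T) :
  bijective f -> a <> b -> a <> c -> a <> e -> b = c \/ b = e \/ c = e.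
Proof.
move=> /bij_inj fI /eqP ab /eqP ac /eqP ae.
have : ~~ uniq [:: a; b; c; e].
  apply/negP; rewrite -(map_inj_uniq fI) => u.
  by have := max_card (mem (map f [:: a; b; c; e]));
    rewrite (card_uniqP u) card_ord.
rewrite /= !inE (negbTE ab) (negbTE ac) (negbTE ae) /= andbT negb_and !negbK.
by move=> /orP[/orP[]|] /eqP; auto.
Qed.

Lemma con3_total {d} (L : latticeType d) (f : {lmorphism Con L -> 'I_3})
    (r s : Con L) :
  bijective f -> (forall p, con_graph r p -> con_graph s p) \/
  (forall p, con_graph s p -> con_graph r p).
Proof.
move=> /bij_inj fI.
have H (r' s' : Con L) : f r' <= f s' ->
    forall p, con_graph r' p -> con_graph s' p.
  rewrite leEmeet -omorphI => /eqP/fI e p.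
  have : r' <= s' by rewrite leEmeet e.
  by rewrite leConE => /asboolP; apply.
by have /orP[/H|/H] := le_total (f r) (f s); auto.
Qed.

(** * The contradiction *)

Theorem corollary6p7 (d : Order.disp_t) (L : latticeType d) :
  lower_bounded L -> ~ isomorphic_lattices (Con L) 'I_3.
Proof.
move=> lbL [f f_bij].
have cg_neq (x y z w : L) : x < y -> y <= z -> z < w ->
    con_gen x y <> con_gen z w.
  move=> xy yz zw e; apply: (lower_bounded_con_neq lbL xy yz (ltW zw)).
    by have := con_gen_gen z w; rewrite -e.
  by have := con_gen_gen x y; rewrite e.
have diag_cg (x y : L) : x < y -> diag_con <> con_gen x y.
  by move=> xy e; have := con_gen_gen x y; rewrite -e /= => exy;
    rewrite exy ltxx in xy.
have n4 : no4chain L.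
  move=> x y z w xy yz zw.
  case: (bij_ord3_pigeonhole f_bij (diag_cg _ _ xy) (diag_cg _ _ yz)
    (diag_cg _ _ zw)).
    exact: cg_neq.
  by case; apply: cg_neq => //; apply: ltW.
have [r [r_diag r_full]] := bij_ord3_neq diag_con full_con f_bij.
have [rR rS rT rI rU] := con_congr r.
(* Without such a chain, [r] relates some [a < b], every element equals [a] or [b], and [r] is
   full. *)
have [o [m [i [om mi]]]] : exists o m i : L, o < m /\ m < i.
  apply: contrapT => n3.
  have [a [b [ab rab]]] : exists a b, a < b /\ con_graph r (a, b).
    apply: contrapT => nr; apply: r_diag; apply: con_ext => -[a b] /=.
    split=> [rab|->]; last exact: rR.
    apply/eqP/contraT => ab; exfalso; apply: nr; exists (a `&` b), (a `|` b).
    split.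
      rewrite lt_neqAle (le_trans (leIl _ _) (leUl _ _)) andbT.
      apply: contra_neq ab => e; apply/le_anti.
      rewrite (le_trans (leUl a b)) -?e ?leIr//=.
      by apply: le_trans (leUr b a) _; rewrite -e leIl.
    have rIb := rI _ _ _ _ rab (rR b); have rUb := rU _ _ _ _ rab (rR b).
    by apply: rT rIb _; rewrite meetxx; apply: rS; rewrite joinxx in rUb.
  apply: r_full; apply: con_ext => -[u v]; split=> // _.
  have ra w : con_graph r (a, w).
    have aw : a <= w.
      rewrite leEmeet; apply/negPn/negP => aw; apply: n3; exists (a `&` w), a, b.
      by rewrite lt_neqAle leIl aw.
    have wb : w <= b.
      rewrite leEjoin; apply/negPn/negP => wb; apply: n3; exists a, b, (w `|` b).
      by split=> //; rewrite lt_neqAle leUr eq_sym wb.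
    have [<-|wa] := eqVneq a w; first exact: rR.
    have [->|wb'] := eqVneq w b; first exact: rab.
    by case: n3; exists a, w, b; rewrite !lt_neqAle wa wb' aw wb.
  exact: rT (rS _ _ (ra u)) (ra v).
have oi u : o <= u <= i.
  apply/andP; split.
    rewrite leEmeet; apply/negPn/negP => ou; apply: (n4 (o `&` u) o m i) => //.
    by rewrite lt_neqAle leIl ou.
  rewrite leEjoin; apply/negPn/negP => ui; apply: (n4 o m i (u `|` i)) => //.
  by rewrite lt_neqAle leUr eq_sym ui.
have omi : o < m < i by rewrite om.
have om_mi : con_gen o m <> con_gen m i by apply: cg_neq.
(* The two principal congruences are distinct and nontrivial, so one is full and the other is
   [r]. *)
have full_cg : con_gen o m = full_con \/ con_gen m i = full_con.
  have diag_full : diag_con <> full_con :> Con L.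
    move=> e; have : con_graph (full_con : Con L) (o, m) by [].
    by rewrite -e /= => eom; rewrite eom ltxx in om.
  by have [] := bij_ord3_pigeonhole f_bij (diag_cg _ _ om)
    (diag_cg _ _ mi) diag_full.
have r_cg : con_gen o m = r \/ con_gen m i = r.
  have diag_r : diag_con <> r by move=> /esym.
  by have [] := bij_ord3_pigeonhole f_bij (diag_cg _ _ om)
    (diag_cg _ _ mi) diag_r.
have not_both : con_graph r (o, m) -> con_graph r (m, i) -> False.
  move=> rom rmi; apply: r_full; apply: con_ext => p; split=> // _.
  by case: full_cg => e; [apply: con_gen_least rom _|apply: con_gen_least rmi _];
    rewrite e.
case: r_cg => er.
  have rom : con_graph r (o, m) by rewrite -er; apply: con_gen_gen.
  have prime := length2_prime n4 oi omi (con_congr r) rom (not_both rom).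
  (* This kernel identifies [m] with [i] but not [o] with [m], and [r] does the opposite, so they
     are incomparable. *)
  have kP := kernel_is_congruence (P := fun u => m <= u)
    (fun u v => lexI m u v) prime.
  have [/(_ _ rom)|] := con3_total r (MkCon (asboolT kP)) f_bij.
    by rewrite /= lexx lt_geF.
  by move=> /(_ (m, i)) /=; rewrite lexx (ltW mi) => /(_ erefl) /(not_both rom).
have rmi : con_graph r (m, i) by rewrite -er; apply: con_gen_gen.
have nrom : ~ con_graph r (o, m) by move=> /not_both; apply.
have prime := length2_coprime n4 oi omi (con_congr r) rmi nrom.
(* The negation makes the predicate order preserving, as the kernel lemma requires. *)
have kP : is_congruence [set p : L * L | ~~ (p.1 <= m) = ~~ (p.2 <= m)]%classic.
  apply: (kernel_is_congruence (P := fun u => ~~ (u <= m))) => u v.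
    by rewrite prime negb_or.
  by rewrite leUx negb_and.
have [/(_ _ rmi)|] := con3_total r (MkCon (asboolT kP)) f_bij.
  by rewrite /= lexx lt_geF.
by move=> /(_ (o, m)) /=; rewrite lexx (ltW om) => /(_ erefl) /nrom.
Qed.
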